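(* Let $(G,\rho,V)$ be a prehomogeneous vector space, and let $h$ be an additive relative invariant of $(G,\rho,V)$ that is not the zero function. Then $h$ may be written as $h=\frac{h_1}{f_1}$, where $h_1$ and $f_1$ are homogeneous polynomials with $\deg(h_1)=\deg(f_1)$, $h_1$ and $f_1$ have no common factors, and $f_1$ is a relative invariant.
   Context: A prehomogeneous vector space $(G,\rho,V)$ is a rational representation $\rho:G\to\mathrm{GL}(V)$ of a connected complex linear algebraic group $G$ on a finite-dimensional complex vector space $V$ having a (unique) Zariski open orbit $\Omega\subseteq V$. A relative invariant is a rational function $f$ on $V$, not identically $0$, for which there is a rational character $\chi:G\to\mathbb{G}_m=\mathrm{GL}_1(\mathbb{C})$ with $f(\rho(g)(v))=\chi(g)f(v)$ for all $v\in\Omega$, $g\in G$. An additive relative invariant is a rational function $h$ on $V$ for which there is a homomorphism of algebraic groups $\Phi:G\to\mathbb{G}_a=(\mathbb{C},+)$ with $h(\rho(g)(v))-h(v)=\Phi(g)$ for all $v\in\Omega$, $g\in G$. *)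

(* Defs.v *)
From HB Require Import structures.
From mathcomp Require Import all_boot all_order all_algebra fraction.
From mathcomp Require Import classical_sets reals complex mpoly.

Set Implicit Arguments.
Unset Strict Implicit.
Unset Printing Implicit Defensive.

Import GRing.Theory.

Local Open Scope classical_set_scope.
Local Open Scope ring_scope.

(* Polynomial functions on W are polynomials in the linear coordinates with
   respect to the basis [vbasis {:W}]; neither the functions so obtained nor
   their degrees depend on the basis. This is used for the representation space
   and for the space of matrices containing the group. *)
Definition peval (R : realType) (W : vectType R[i])
    (p : {mpoly R[i][\dim {:W}]}) (w : W) : R[i] :=
  p.@[fun i => coord (vbasis {:W}) i w].

Definition zariski_closed (R : realType) (W : vectType R[i]) (A : set W) : Prop :=
  exists S : set {mpoly R[i][\dim {:W}]},
    A = [set w | forall p, S p -> peval p w = 0].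

Definition zariski_open (R : realType) (W : vectType R[i]) (A : set W) : Prop :=
  zariski_closed (~` A).

(* Connectedness of A for the topology induced by the Zariski topology. *)
Definition zariski_connected (R : realType) (W : vectType R[i]) (A : set W) : Prop :=
  forall Z1 Z2 : set W, zariski_closed Z1 -> zariski_closed Z2 ->
    A `<=` Z1 `|` Z2 -> A `&` (Z1 `&` Z2) = set0 ->
    A `&` Z1 = set0 \/ A `&` Z2 = set0.

(* A Zariski closed subgroup of GL_m(C). *)
Record linear_algebraic_group (R : realType) (m : nat) (G : set 'M[R[i]]_m) : Prop :=
  LinearAlgebraicGroup {
    lag_closed : exists2 Z : set 'M[R[i]]_m,
      zariski_closed Z & G = Z `&` [set g | g \in unitmx];
    lag_one : G 1%:M;
    lag_mul : forall g g', G g -> G g' -> G (g *m g');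
    lag_inv : forall g, G g -> G (invmx g) }.

(* The coordinate ring of GL_m is generated by the matrix entries and 1/det,
   and regular functions on G are the restrictions of its elements. Only the
   values of F on G matter, here and for the morphisms below. *)
Definition regular_on (R : realType) (m : nat) (G : set 'M[R[i]]_m)
    (F : 'M[R[i]]_m -> R[i]) : Prop :=
  exists (p : {mpoly R[i][\dim {:'M[R[i]]_m}]}) (k : nat),
    forall g, G g -> F g = peval p g / (\det g) ^+ k.

Record rational_representation (R : realType) (m : nat) (G : set 'M[R[i]]_m)
    (V : vectType R[i]) (rho : 'M[R[i]]_m -> 'End(V)) : Prop :=
  RationalRepresentation {
    rep_inj : forall g, G g -> lker (rho g) == 0%VS;
    rep_mul : forall g g', G g -> G g' -> rho (g *m g') = (rho g \o rho g')%VF;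
    rep_regular : forall v i,
      regular_on G (fun g => coord (vbasis {:V}) i (rho g v)) }.

(* Omega is the open orbit. *)
Record prehomogeneous (R : realType) (m : nat) (G : set 'M[R[i]]_m)
    (V : vectType R[i]) (rho : 'M[R[i]]_m -> 'End(V)) (Omega : set V) : Prop :=
  Prehomogeneous {
    phv_group : linear_algebraic_group G;
    phv_connected : zariski_connected G;
    phv_rep : rational_representation G rho;
    phv_orbit : exists v0 : V, Omega = [set rho g v0 | g in G];
    phv_open : zariski_open Omega }.

(* Homomorphisms of algebraic groups G -> G_m and G -> G_a. *)
Record rational_character (R : realType) (m : nat) (G : set 'M[R[i]]_m)
    (chi : 'M[R[i]]_m -> R[i]) : Prop :=
  RationalCharacter {
    char_neq0 : forall g, G g -> chi g != 0;
    char_mul : forall g g', G g -> G g' -> chi (g *m g') = chi g * chi g';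
    char_regular : regular_on G chi }.

Record additive_character (R : realType) (m : nat) (G : set 'M[R[i]]_m)
    (Phi : 'M[R[i]]_m -> R[i]) : Prop :=
  AdditiveCharacter {
    achar_add : forall g g', G g -> G g' -> Phi (g *m g') = Phi g + Phi g';
    achar_regular : regular_on G Phi }.

(* The rational function f is defined at v, with value c. *)
Definition rat_value (R : realType) (V : vectType R[i])
    (f : {fraction {mpoly R[i][\dim {:V}]}}) (v : V) (c : R[i]) : Prop :=
  exists p q : {mpoly R[i][\dim {:V}]},
    [/\ f = tofrac p / tofrac q, peval q v != 0 & c = peval p v / peval q v].

(* The identities defining the two kinds of invariants are required at the
   points of Omega where both sides are defined. They then hold as identities
   of rational functions, so the domain of the invariant is G-stable and
   contains Omega. *)
Definition relative_invariant (R : realType) (m : nat) (G : set 'M[R[i]]_m)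
    (V : vectType R[i]) (rho : 'M[R[i]]_m -> 'End(V)) (Omega : set V)
    (f : {fraction {mpoly R[i][\dim {:V}]}}) : Prop :=
  f != 0 /\
  exists2 chi : 'M[R[i]]_m -> R[i], rational_character G chi &
    forall v g a b, Omega v -> G g ->
      rat_value f v a -> rat_value f (rho g v) b -> b = chi g * a.

Definition additive_relative_invariant (R : realType) (m : nat)
    (G : set 'M[R[i]]_m) (V : vectType R[i]) (rho : 'M[R[i]]_m -> 'End(V))
    (Omega : set V) (h : {fraction {mpoly R[i][\dim {:V}]}}) : Prop :=
  exists2 Phi : 'M[R[i]]_m -> R[i], additive_character G Phi &
    forall v g a b, Omega v -> G g ->
      rat_value h v a -> rat_value h (rho g v) b -> b - a = Phi g.

Definition mpoly_dvd (R : realType) (n : nat) (p q : {mpoly R[i][n]}) : Prop :=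
  exists r : {mpoly R[i][n]}, q = p * r.

Definition no_common_factor (R : realType) (n : nat) (p q : {mpoly R[i][n]}) : Prop :=
  forall d : {mpoly R[i][n]},
    mpoly_dvd d p -> mpoly_dvd d q -> d \is a GRing.unit.

(* Main.v *)
Require Import Defs.
From HB Require Import structures.
From mathcomp Require Import all_boot all_order all_algebra fraction.
From mathcomp Require Import classical_sets reals complex mpoly.
From mathcomp Require Import perm perm generic_quotient ring zify boolp.

(** Write [h = p / q] in lowest terms. Since [h (g v) = h v + Phi g], the
    fraction [h o g] has denominators [q o g] and [q], so unique factorization
    gives [q o g = chi g * q], and then [p o g = chi g * (p + Phi g * q)].
    For the dilation [t = 2], both [(p o t) q - p (q o t)] and [(q o t) q] are
    semi-invariant with character [chi ^ 2], so on the single orbit [Omega],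
    which is dense, they are proportional: [h o t = h + k] for a constant [k].
    The argument used for [g] now applies to [t] and gives [q o t = e * q] and
    [p o t = e * (p + k * q)]; comparing coefficients, [e = 2 ^ d] and both [q]
    and [p] are homogeneous of degree [d]. *)

Set Implicit Arguments.
Unset Strict Implicit.
Unset Printing Implicit Defensive.

Import GRing.Theory Pdiv.Idomain.

Local Open Scope ring_scope.

(** * Divisibility and prime factorisation in an integral domain *)

Definition divides (A : idomainType) (a b : A) := exists c, b = a * c.

Definition prime_elt (A : idomainType) (p : A) :=
  [/\ p != 0, p \isn't a GRing.unit
    & forall a b, divides p (a * b) -> divides p a \/ divides p b].

(** The index counts the prime factors and serves as an induction measure. Factors are required to
    be prime rather than irreducible, so uniqueness need not be postulated. *)
Inductive prime_fact (A : idomainType) : nat -> A -> Prop :=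
| prime_fact_unit u : u \is a GRing.unit -> prime_fact 0 u
| prime_fact_mul k p a :
    prime_elt p -> prime_fact k a -> prime_fact k.+1 (p * a).

Definition factorial_domain (A : idomainType) :=
  forall a : A, a != 0 -> exists k, prime_fact k a.

Section Divisibility.
Variable A : idomainType.
Implicit Types a b c p u : A.

Lemma dividesMr p a b : divides p a -> divides p (a * b).
Proof. by case=> c ->; exists (c * b); rewrite mulrA. Qed.

Lemma dividesMl p a b : divides p b -> divides p (a * b).
Proof. by rewrite mulrC; apply: dividesMr. Qed.

Lemma dividesD p a b : divides p a -> divides p b -> divides p (a + b).
Proof. by case=> c -> [d ->]; exists (c + d); rewrite mulrDr. Qed.

Lemma dividesDr p a b : divides p a -> divides p (a + b) -> divides p b.
Proof.
by case=> c -> [d e]; exists (d - c); rewrite mulrBr -e addrC addKr.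
Qed.

Lemma prime_fact_unitl k u a :
  u \is a GRing.unit -> prime_fact k a -> prime_fact k (u * a).
Proof.
move=> Uu; case=> [v Uv|l p b Pp Fb].
  by apply: prime_fact_unit; rewrite unitrM Uu.
have [p0 Np Dp] := Pp; rewrite mulrA; apply: prime_fact_mul => //.
split; first by rewrite mulf_neq0 //; apply: contraTneq Uu => ->;
  rewrite unitr0.
  by rewrite unitrM (negPf Np) andbF.
have up x : divides (u * p) x <-> divides p x.
  split=> [[c ->]|[c ->]]; first by exists (u * c); rewrite mulrCA mulrA.
  by exists (u^-1 * c); rewrite mulrACA mulrV // mul1r.
by move=> x y; rewrite !up; apply: Dp.
Qed.

(** Induction on the factorisation: either [p] divides its first prime [q], and then the two are
    associate and cancel up to a unit, or [p] divides the remaining product. *)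
Lemma prime_factV k p a :
  prime_elt p -> prime_fact k (p * a) -> exists2 l, k = l.+1 & prime_fact l a.
Proof.
move=> Pp; have [p0 Np Dp] := Pp; move ex: (p * a) => x Fx.
elim: Fx a ex => {k x} [u Uu a eu|k q b Pq Fb IH a e].
  by move: Uu; rewrite -eu unitrM (negPf Np).
exists k => //; have [q0 Nq Dq] := Pq.
have /Dp[] : divides p (q * b) by rewrite -e; exists a.
  case=> u eq; have : divides q (p * u) by rewrite -eq; exists 1; rewrite mulr1.
  case/Dq=> -[w ew]; last first.
    case/negP: Np; apply/unitrPr; exists w.
    by apply: (mulfI q0); rewrite mulr1 {2}eq ew; rewrite mulrCA.
  have Uu : u \is a GRing.unit.
    apply/unitrPr; exists w; apply: (mulfI p0).
    by rewrite mulr1 mulrA -eq -ew.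
  have -> : a = u * b by apply: (mulfI p0); rewrite e eq mulrA.
  exact: prime_fact_unitl.
case=> c ec; have [l ek Fc] := IH c (esym ec).
have -> : a = q * c by apply: (mulfI p0); rewrite e ec mulrCA.
by rewrite ek; apply: prime_fact_mul.
Qed.

Lemma prime_fact_nonunit k a : prime_fact k a -> a \isn't a GRing.unit ->
  exists2 p, prime_elt p & divides p a.
Proof.
case=> {k a} [u -> //|k p a Pp _ _]; exists p => //.
by exists a.
Qed.

Lemma prime_factM k l a b :
  prime_fact k a -> prime_fact l b -> prime_fact (k + l) (a * b).
Proof.
move=> Fa Fb; elim: Fa => {k a} [u Uu|k p a Pp _ IH].
  exact: prime_fact_unitl.
by rewrite -mulrA; apply: prime_fact_mul.
Qed.

(** Coprimality takes the form of a cancellation law. The primes of [b] are treated one by one: one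
    that divides what is left of [a] goes into [d], any other into [b']. In the second case [p]
    divides [a' * c1] but not [a'], hence [c1]. *)
Lemma coprime_decomposition k a b : prime_fact k b ->
  exists d a' b', [/\ a = a' * d, b = b' * d
    & forall c, divides b' (a' * c) -> divides b' c].
Proof.
move=> Fb; elim: Fb a => {k b} [u Uu|k p b Pp _ IH] a.
  exists 1, a, u; rewrite !mulr1; split=> // c _.
  by exists (u^-1 * c); rewrite mulVKr.
have [p0 _ Dp] := Pp; have [[a1 ->]|Npa] := EM (divides p a).
  have [d [a' [b' [-> -> H]]]] := IH a1.
  by exists (p * d), a', b'; split=> //; rewrite mulrCA.
have [d [a' [b' [ea eb H]]]] := IH a.
exists d, a', (p * b'); split=> //; first by rewrite eb mulrA.
move=> c [x ex]; have [c1 ec1] : divides b' c.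
  by apply: H; exists (p * x); rewrite ex mulrCA mulrA.
have [b0|b0] := eqVneq b' 0; first by exists 0; rewrite ec1 b0 !mul0r mulr0.
have /Dp[[y ey]|[y ey]] : divides p (a' * c1).
    by exists x; apply: (mulfI b0); rewrite mulrCA -ec1 ex mulrCA mulrA.
  by case: Npa; exists (y * d); rewrite ea ey mulrA.
by exists y; rewrite ec1 ey mulrCA mulrA.
Qed.

(** The cancellation law is applied to the cofactor [y] of [d] in [b]: since [a * y] is a multiple
    of [b], so is [y], which makes [d] invertible. *)
Lemma coprime_common_divisor a b d : b != 0 ->
    (forall c, divides b (a * c) -> divides b c) ->
  divides d a -> divides d b -> d \is a GRing.unit.
Proof.
move=> b0 H [x ea] [y eb]; have [z ez] : divides b y.
  by apply: H; exists x; rewrite ea eb mulrAC.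
have y0 : y != 0 by apply: contraNneq b0 => y0; rewrite eb y0 mulr0.
apply/unitrPr; exists z; apply: (mulfI y0).
by rewrite mulr1 {2}ez eb mulrCA mulrA.
Qed.

End Divisibility.

(** * Gauss's lemma: polynomials over a factorial domain form a factorial domain *)

Section GaussLemma.
Variable A : idomainType.
Implicit Types (p c : A) (f g : {poly A}).

Lemma polyC_divides p (f : {poly A}) :
  (forall i, divides p f`_i) -> divides p%:P f.
Proof.
elim/poly_ind: f => [|f c IH] H; first by exists 0; rewrite mulr0.
have /IH [g ->] : forall i, divides p f`_i.
  by move=> i; have := H i.+1; rewrite coefD coefMX coefC addr0.
have [d ->] : divides p c by have := H 0%N; rewrite coefD coefMX coefC add0r.
by exists (g * 'X + d%:P); rewrite mulrDr mulrA -polyCM.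
Qed.

Lemma divides_coef p (f : {poly A}) i : divides p%:P f -> divides p f`_i.
Proof. by case=> g ->; exists g`_i; rewrite coefCM. Qed.

Lemma divides_MX p (f : {poly A}) : divides p%:P (f * 'X) -> divides p%:P f.
Proof.
move=> D; apply: polyC_divides => i.
by have := divides_coef i.+1 D; rewrite coefMX.
Qed.

(** Low-order terms are stripped off. A constant term of the first factor divisible by [p] is
    subtracted; once one is not divisible, the constant terms of [g] must be, one after the
    other. *)
Lemma prime_polyC p : prime_elt p -> prime_elt p%:P.
Proof.
move=> [p0 Np Dp]; split; first by rewrite polyC_eq0.
  by rewrite poly_unitE coefC /= (negPf Np) andbF.
elim/poly_ind=> [|f c IHf] g D; first by left; exists 0; rewrite mulr0.
have [Dc|Nc] := EM (divides p c).
  have DC : divides p%:P c%:P by case: Dc => d ->; exists d%:P; rewrite polyCM.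
  have : divides p%:P (f * g * 'X).
    by apply: (dividesDr (dividesMr g DC)); rewrite addrC mulrAC -mulrDl.
  move/divides_MX/IHf=> [Df|]; last by right.
  by left; apply: dividesD => //; apply: dividesMr.
right; elim/poly_ind: g D => [|g d IHg] D; first by exists 0; rewrite mulr0.
have /Dp[//|[e ed]] : divides p (c * d).
  have := divides_coef 0 D.
  by rewrite coef0M !coefD !coefMX !coefC !add0r.
have Dd : divides p%:P d%:P by exists e%:P; rewrite ed polyCM.
apply: dividesD => //; apply: dividesMr; apply: IHg.
apply: divides_MX.
apply: (dividesDr (dividesMl (f * 'X + c%:P) Dd)).
by rewrite addrC -mulrA -mulrDr.
Qed.

(** Content one, expressed without greatest common divisors. *)
Definition primitive_poly f := forall p, prime_elt p -> ~ divides p%:P f.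

(** A prime [p] of [c] divides [f * h] but not [f], so it divides [h] and cancels; the primes of [c]
    disappear one at a time. *)
Lemma primitive_divides f g k c :
  primitive_poly f -> prime_fact k c -> divides f (c%:P * g) -> divides f g.
Proof.
move=> prf Fc; elim: Fc g => {k c} [u Uu|k p c Pp _ IH] g [h e].
  exists (u^-1%:P * h); rewrite mulrCA -e mulrA -polyCM mulVr //.
  by rewrite mul1r.
have [pP0 _ Dp] := prime_polyC Pp.
have /Dp[/(prf _ Pp)//|[h' eh]] : divides p%:P (f * h).
  by exists (c%:P * g); rewrite -e polyCM mulrA.
apply: IH; exists h'; apply: (mulfI pP0).
by rewrite [LHS]mulrA -polyCM e eh mulrCA.
Qed.

(** Turns a factorisation of [f] up to a constant into a genuine one: by Gauss's lemma each prime of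
    [c] divides [g] or [h], and is moved into [a] or [b] accordingly. *)
Lemma cancel_constant_factor k c f g h : prime_fact k c -> c%:P * f = g * h ->
  exists a b g' h',
    [/\ g = a%:P * g', h = b%:P * h', a != 0, b != 0 & f = g' * h'].
Proof.
move=> Fc; elim: Fc g h => {k c} [u Uu|k p c Pp _ IH] g h e.
  have u0 : u != 0 by apply: contraTneq Uu => ->; rewrite unitr0.
  exists u, 1, (u^-1%:P * g), h; rewrite mul1r oner_neq0; split=> //.
    by rewrite mulrA -polyCM mulrV // mul1r.
  by rewrite -mulrA -e mulrA -polyCM mulVr // mul1r.
have [pP0 _ Dp] := prime_polyC Pp; have [p0 _ _] := Pp.
have : divides p%:P (g * h) by exists (c%:P * f); rewrite -e polyCM mulrA.
case/Dp=> -[x ex].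
  have /IH[a [b [g' [h' [ex' -> a0 b0 ->]]]]] : c%:P * f = x * h.
    by apply: (mulfI pP0); rewrite [LHS]mulrA -polyCM e ex mulrA.
  exists (p * a), b, g', h'; split=> //; last exact: mulf_neq0.
  by rewrite ex ex' polyCM mulrA.
have /IH[a [b [g' [h' [-> ex' a0 b0 ->]]]]] : c%:P * f = g * x.
  by apply: (mulfI pP0); rewrite [LHS]mulrA -polyCM e ex mulrCA.
exists a, (p * b), g', h'; split=> //; last exact: mulf_neq0.
by rewrite ex ex' polyCM mulrA.
Qed.

Hypothesis factA : factorial_domain A.

(* Descent on the size of the elements [x] of the ideal [(a, f)]. Unless a
   pseudo-remainder gives a smaller one, [x] divides [f] and [a] up to constant
   factors. Then either [x] is a constant and [f] divides [b], or [x] is associate to [f]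
   up to a constant and [f] divides [a]. *)
Lemma primitive_irreducible_prime f :
    (1 < size f)%N -> primitive_poly f ->
    (forall g h : {poly A}, f = g * h -> size g = 1%N \/ size h = 1%N) ->
  prime_elt f.
Proof.
move=> sf prf irf.
have f0 : f != 0 by apply: contraTneq sf => ->; rewrite size_poly0.
split=> // [|a b [w eab]].
  by rewrite poly_unitE; apply: contraL sf => /andP[/eqP-> _].
pose J (x : {poly A}) := exists u v : {poly A}, x = u * a + v * f.
have main n : forall x : {poly A}, (size x <= n)%N -> x != 0 -> J x ->
    divides f a \/ divides f b.
  elim: n => [|n IH] x sx x0 Jx.
    by rewrite -size_poly_eq0 -leqn0 sx in x0.
  have red y : J y -> x %| y \/ (divides f a \/ divides f b).
    move=> Jy; have [/modp_eq0P|r0] := eqVneq (y %% x) 0; [by left|right].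
    apply: IH r0 _; first by rewrite -ltnS (leq_trans _ sx) // ltn_modp.
    have -> : y %% x = lead_coef x ^+ scalp y x *: y - y %/ x * x.
      by rewrite divp_eq [X in X - _]addrC addrK.
    move: (lead_coef x ^+ _) (y %/ x) => s t.
    case: Jy Jx => u [v ->] [u' [v' ->]].
    exists (s%:P * u - t * u'), (s%:P * v - t * v').
    by rewrite -mul_polyC; ring.
  have [] // := red f; first by exists 0, 1; rewrite mul0r mul1r add0r.
  have [] // := red a; first by exists 1, 0; rewrite mul0r mul1r addr0.
  move=> /dvdpP[[c k] /= c0 ea] /dvdpP[[c' k'] /= c'0 ef].
  have [l Fc] := factA c0; have [l' Fc'] := factA c'0.
  have [/eqP sx1|sx1] := boolP (size x == 1%N); [right|left].
    case: Jx x0 sx1 => u [v ex] x0 /eqP/size_poly1P[d d0 ed].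
    have [m Fd] := factA d0; apply: (primitive_divides prf Fd).
    exists (u * w + v * b).
    rewrite -ed ex mulrDl -mulrA eab mulrDr.
    by congr (_ + _); rewrite mulrCA // -mulrA mulrCA.
  rewrite -mul_polyC in ef.
  have [d [e [k1 [x1 [ek ex d0 e0 ekx]]]]] := cancel_constant_factor Fc' ef.
  apply: (primitive_divides prf Fc); rewrite mul_polyC ea ex.
  case: (irf _ _ ekx) => s1; last first.
    by case/negP: sx1; rewrite ex size_Cmul // s1.
  move/eqP/size_poly1P: s1 => [z z0 ez].
  have [m Fz] := factA z0.
  (* A prime factor of [z] would be a constant prime dividing the primitive polynomial [f]. *)
  have Uz : z \is a GRing.unit.
    apply/negPn/negP => /(prime_fact_nonunit Fz)[p Pp [y ey]].
    by apply: (prf _ Pp); exists (y%:P * x1); rewrite ekx ez ey polyCM mulrA.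
  exists (k * e%:P * z^-1%:P); rewrite ekx ez.
  have zz : z%:P * z^-1%:P = 1 :> {poly A} by rewrite -polyCM mulrV.
  by rewrite -[in LHS](mul1r x1) -zz; ring.
apply: (main (size f) f) => //; exists 0, 1.
by rewrite mul0r mul1r add0r.
Qed.

(** Induction on the size of [f], then on the number of primes in its leading coefficient.
    Extracting a constant prime lowers the second measure, splitting into two nonconstant factors
    lowers the first. What remains is a unit, or a primitive polynomial with no such splitting,
    which is prime. *)
Lemma factorial_poly : factorial_domain {poly A}.
Proof.
move=> f; have [n] := ubnP (size f); elim: n f => // n IHn f sf f0.
have lf0 : lead_coef f != 0 by rewrite lead_coef_eq0.
have [k Ff] := factA lf0.
elim/ltn_ind: k f sf f0 lf0 Ff => k IHk f sf f0 lf0 Ff.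
have [[p Pp [g ef]]|prf] := EM (exists2 p, prime_elt p & divides p%:P f).
  have [p0 _ _] := Pp.
  have lf : lead_coef f = p * lead_coef g by rewrite ef lead_coefM lead_coefC.
  rewrite lf in Ff; have [l ek Fg] := prime_factV Pp Ff.
  have g0 : g != 0 by apply: contraNneq f0 => g0; rewrite ef g0 mulr0.
  have [||||l' Fg'] := IHk l _ g _ g0; rewrite ?ek ?lead_coef_eq0 //.
    by move: sf; rewrite ef size_Cmul.
  by exists l'.+1; rewrite ef; apply: prime_fact_mul => //; apply: prime_polyC.
have {}prf : primitive_poly f by move=> p Pp D; apply: prf; exists p.
have [/size_poly1P[c c0 ec]|sf1] := boolP (size f == 1%N).
  exists 0%N; apply: prime_fact_unit.
  rewrite poly_unitE ec size_polyC c0 coefC /=.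
  rewrite ec lead_coefC in Ff; apply/negPn/negP => Nc.
  have [p Pp [y ey]] := prime_fact_nonunit Ff Nc.
  by apply: (prf _ Pp); exists y%:P; rewrite ec ey polyCM.
have sf2 : (1 < size f)%N by rewrite ltn_neqAle eq_sym sf1 size_poly_gt0.
have [[g [h [ef sg sh]]]|irf] :=
    EM (exists g h, [/\ f = g * h, size g != 1%N & size h != 1%N]).
  have g0 : g != 0 by apply: contraNneq f0 => g0; rewrite ef g0 mul0r.
  have h0 : h != 0 by apply: contraNneq f0 => h0; rewrite ef h0 mulr0.
  have sg0 : (0 < size g)%N by rewrite size_poly_gt0.
  have sh0 : (0 < size h)%N by rewrite size_poly_gt0.
  have sgh : size f = (size g + size h).-1 by rewrite ef size_mul.
  have [|l Fg] := IHn g _ g0; first by lia.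
  have [|l' Fh] := IHn h _ h0; first by lia.
  by exists (l + l')%N; rewrite ef; apply: prime_factM.
exists 1%N; rewrite -[f]mulr1; apply: prime_fact_mul; last first.
  by apply: prime_fact_unit; rewrite unitr1.
apply: primitive_irreducible_prime => // g h ef.
have [/eqP|sg] := boolP (size g == 1%N); [by left|right].
apply/eqP/negPn/negP => sh; apply: irf.
by exists g, h.
Qed.

End GaussLemma.

(** Primes and units are carried back by [g], a bare function whose multiplicativity follows from
    its being inverse to [f]. *)
Lemma factorial_iso (A B : idomainType) (f : {rmorphism A -> B}) (g : B -> A) :
  cancel f g -> cancel g f -> factorial_domain B -> factorial_domain A.
Proof.
move=> fK gK factB.
have gM : {morph g : x y / x * y}.
  by move=> x y; apply: (can_inj fK); rewrite rmorphM !gK.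
have gU u : u \is a GRing.unit -> g u \is a GRing.unit.
  move=> Uu; apply/unitrPr; exists (g u^-1).
  by rewrite -gM mulrV // -(rmorph1 f) fK.
have gD b x : divides (g b) x <-> divides b (f x).
  split=> -[c e]; first by exists (f c); rewrite e rmorphM gK.
  by exists (g c); rewrite -gM -e fK.
have gP b : prime_elt b -> prime_elt (g b).
  move=> [b0 Nb Db]; split=> [||x y].
  - by apply: contraNneq b0 => gb0; rewrite -(gK b) gb0 rmorph0.
  - by apply: contra Nb => /(rmorph_unit f); rewrite gK.
  - by rewrite !gD rmorphM; apply: Db.
move=> a a0; have fa0 : f a != 0.
  by apply: contraNneq a0 => fa0; rewrite -(fK a) fa0 -(rmorph0 f) fK.
have [k Fk] := factB _ fa0; exists k; rewrite -(fK a).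
elim: Fk => {k a a0 fa0} [u Uu|k p a Pp _ IH]; first exact/prime_fact_unit/gU.
by rewrite gM; apply: prime_fact_mul => //; apply: gP.
Qed.

(** * Polynomials in [n.+1] variables as univariate polynomials over those in [n] variables *)

Section MpolyUni.
Variables (n : nat) (R : idomainType).
Local Notation widen := (widen_ord (leqnSn _)).

(** Exhibits [mmulti] as a composite of ring morphisms, which gives its additivity and its behaviour
    under evaluation. *)
Lemma mmultiE (P : {poly {mpoly R[n]}}) :
  mmulti P = (map_poly (@mwiden n R) P).['X_ord_max].
Proof.
rewrite (@horner_coef_wide _ (size P)) ?size_poly //.
by apply: eq_bigr => i _; rewrite coef_map.
Qed.

Lemma muni_X m : muni 'X_[m] =
  'X_[[multinom m (widen i) | i < n]] *: 'X^(m ord_max) :> {poly {mpoly R[n]}}.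
Proof. by rewrite muniE msuppX big_seq1 mcoeffX eqxx scale1r. Qed.

Lemma mnmwidenK (m : 'X_{1..n}) : [multinom mnmwiden m (widen i) | i < n] = m.
Proof. by apply/mnmP=> i; rewrite mnmE mnmwiden_widen. Qed.

Lemma muni_mwiden (p : {mpoly R[n]}) : muni (mwiden p) = p%:P.
Proof.
elim/mpolyind: p => [|c m p _ _ IH]; first by rewrite mwiden0 muni0.
rewrite mwidenD muniD mwidenZ muniZ IH mwidenX muni_X mnmwidenK mnmwiden_ordmax.
by rewrite expr0 -!mul_polyC mulr1 -polyCM polyCD mul_mpolyC.
Qed.

Lemma muni_Xmax : muni 'X_ord_max = 'X :> {poly {mpoly R[n]}}.
Proof.
rewrite muni_X mnm1E eqxx expr1; set m := [multinom _ | _ < _].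
suff -> : m = 0%MM by rewrite mpolyX0 scale1r.
by apply/mnmP=> i; rewrite mnmE mnm1E mnm0E; case: eqP => // /(congr1 val) /= e;
  have := ltn_ord i; rewrite -e ltnn.
Qed.

Lemma mmultiK : cancel (@mmulti n R) (@muni n R).
Proof.
elim/poly_ind => [|P c IH]; first by rewrite mmultiE rmorph0 horner0 muni0.
rewrite mmultiE rmorphD rmorphM /= map_polyX map_polyC /= hornerMXaddC -mmultiE.
by rewrite muniD muniM IH muni_mwiden muni_Xmax.
Qed.

Lemma mmultiD (P Q : {poly {mpoly R[n]}}) :
  mmulti (P + Q) = mmulti P + mmulti Q.
Proof. by rewrite [LHS]mmultiE rmorphD hornerD (mmultiE P) (mmultiE Q). Qed.

Lemma muniK : cancel (@muni n R) (@mmulti n R).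
Proof.
elim/mpolyind => [|c m p _ _ IH].
  by rewrite muni0 mmultiE rmorph0 horner0.
rewrite (muniD (c *: _) p) (mmultiD (muni _)).
apply: (congr2 _ _ IH).
rewrite muniZ muni_X mmultiE -!mul_polyC !rmorphM /= !map_polyC map_polyXn /=.
rewrite !hornerM !hornerC hornerXn mwidenC mul_mpolyC mwidenX; congr (_ *: _).
rewrite mpolyXn -mpolyXD; congr 'X_[_]; apply/mnmP=> i.
rewrite mnmDE mulmnE mnm1E.
have [lt_in|le_ni] := ltnP i n.
  have -> : i = widen (Ordinal lt_in) by apply: val_inj.
  by rewrite mnmwiden_widen mnmE -val_eqE /= gtn_eqF ?mul0n ?addn0.
have -> : i = ord_max by apply/val_inj/eqP; rewrite eqn_leq le_ni -ltnS ltn_ord.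
by rewrite mnmwiden_ordmax eqxx mul1n.
Qed.

Lemma meval_mwiden v (p : {mpoly R[n]}) :
  (mwiden p).@[v] = p.@[fun i => v (widen i)].
Proof.
elim/mpolyind: p => [|c m p _ _ IH]; first by rewrite mwiden0 !meval0.
rewrite mwidenD !mevalD IH mwidenZ !mevalZ mwidenX !mevalX big_ord_recr /=.
rewrite mnmwiden_ordmax expr0 mulr1; congr (_ * _ + _).
by apply: eq_bigr => i _; rewrite mnmwiden_widen.
Qed.

Lemma meval_mmulti v (P : {poly {mpoly R[n]}}) : (mmulti P).@[v] =
  (map_poly (meval (fun i => v (widen i))) P).[v ord_max].
Proof.
rewrite mmultiE -horner_map /= mevalXU -map_poly_comp; congr (_.[_]).
by apply: eq_map_poly => p /=; rewrite meval_mwiden.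
Qed.

End MpolyUni.

Lemma mpoly_no_var (R : nzRingType) (p : {mpoly R[0]}) : p = (p@_0)%:MP.
Proof.
apply/mpolyP=> m; rewrite mcoeffC; suff -> : m = 0%MM by rewrite eqxx mulr1.
by apply/mnmP=> -[].
Qed.

Lemma factorial_mpoly n (K : fieldType) : factorial_domain {mpoly K[n]}.
Proof.
elim: n => [|n IH].
  move=> p p0; exists 0%N; apply: prime_fact_unit.
  have ep := mpoly_no_var p.
  have c0 : p@_0 != 0 by apply: contraNneq p0 => c0; rewrite ep c0.
  by apply/unitrPr; exists (p@_0)^-1%:MP; rewrite {1}ep -mpolyCM mulfV.
exact: (factorial_iso (@muniK n K) (@mmultiK n K) (factorial_poly IH)).
Qed.

(** * Polynomials vanishing at every point *)

Lemma poly_eval_eq0 (K : numFieldType) (p : {poly K}) :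
  (forall x, p.[x] = 0) -> p = 0.
Proof.
(* In characteristic zero the integers below [size p] are distinct roots, one too many for a nonzero
   [p]. *)
move=> p0; apply: (@roots_geq_poly_eq0 _ _ [seq i%:R | i <- iota 0 (size p)]).
- by apply/allP=> x _; apply/eqP/p0.
- rewrite map_inj_uniq ?iota_uniq // => i j /eqP.
  by rewrite Num.Theory.eqr_nat => /eqP.
- by rewrite size_map size_iota.
Qed.

Lemma mpoly_eval_eq0 n (K : numFieldType) (p : {mpoly K[n]}) :
  (forall v, p.@[v] = 0) -> p = 0.
Proof.
elim: n p => [|n IH] p p0.
  have := p0 (fun=> 0); rewrite [p]mpoly_no_var mevalC => ->.
  by rewrite mpolyC0.
rewrite -[p]muniK; suff -> : muni p = 0 by rewrite mmultiE rmorph0 horner0.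
apply/polyP=> k; rewrite coef0; apply: IH => v.
suff : map_poly (meval v) (muni p) = 0.
  by move/polyP/(_ k); rewrite coef_map coef0.
apply: poly_eval_eq0 => x.
(* The point [v] extended by [x] as last coordinate. *)
pose w (i : 'I_n.+1) := oapp v x (insub (val i)).
have wx : w ord_max = x by rewrite /w insubF //= ltnn.
have wv : (fun i => w (widen_ord (leqnSn n) i)) =1 v.
  by move=> i; rewrite /w /= valK.
have := p0 w; rewrite -[p in p.@[_]]muniK meval_mmulti wx => e; rewrite -[RHS]e.
by congr (_.[_]); apply: eq_map_poly => q; apply: meval_eq => i; rewrite wv.
Qed.

(** * Fractions in lowest terms *)

Lemma fraction_quotient (A : idomainType) (h : {fraction A}) :
  exists p q, q != 0 /\ h = tofrac p / tofrac q.
Proof.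
elim/quotW: h => x; exists (frac x).1, (frac x).2.
split; first exact: denom_ratioP.
have d0 := denom_ratioP x.
rewrite -[RHS]/(FracField.mul (tofrac _) (FracField.inv (tofrac _))) !piE.
apply/eqmodP; rewrite /= FracField.equivfE /FracField.mulf /FracField.invf.
by rewrite !numden_Ratio ?oner_neq0 ?mulf_neq0 ?oner_neq0 // mul1r mulr1 mulrC.
Qed.

Lemma reduced_fraction (A : idomainType) (h : {fraction A}) :
  factorial_domain A -> exists p q, [/\ q != 0, h = tofrac p / tofrac q
    & forall c, divides q (p * c) -> divides q c].
Proof.
move=> factA; have [a [b [b0 ->]]] := fraction_quotient h.
have [k Fb] := factA _ b0.
have [d [p [q [ea eb cop]]]] := coprime_decomposition a Fb.
have /[!mulf_eq0]/[!negb_or]/andP[q0 d0] : q * d != 0 by rewrite -eb.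
exists p, q; split=> //.
by rewrite ea eb !tofracM invfM mulrACA mulfV ?mulr1 // tofrac_eq0.
Qed.

(** * Polynomial functions on a vector space and linear substitution *)

Lemma mcoeff_comp_scale n (R : comNzRingType) (c : R)
    (t : n.-tuple {mpoly R[n]}) (et : forall i, tnth t i = c *: 'X_i) p m :
  (p \mPo t)@_m = c ^+ mdeg m * p@_m.
Proof.
elim/mpolyind: p => [|d m' p _ _ IH].
  by rewrite comp_mpoly0 !mcoeff0 mulr0.
rewrite (comp_mpolyD t) [LHS]mcoeffD IH mcoeffD mulrDr; congr (_ + _).
rewrite comp_mpolyZ !mcoeffZ mcoeffX.
rewrite comp_mpolyX (eq_bigr (fun i => c ^+ m' i *: 'X_i ^+ m' i)); last first.
  by move=> i _; rewrite et exprZn.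
rewrite scaler_prod -mpolyXE_id mcoeffZ mcoeffX prodrXr -mdegE.
by case: eqP => [->|_]; rewrite ?mulr0 // !mulr1 mulrC.
Qed.

(* For [K := R[i]] this is convertible to [peval]. *)
Definition poly_fun (K : fieldType) (V : vectType K)
    (p : {mpoly K[\dim {:V}]}) (v : V) : K :=
  p.@[fun i => coord (vbasis {:V}) i v].

Section Substitution.
Variables (K : numFieldType) (V : vectType K).
Local Notation n := (\dim {:V}).
Implicit Types (p q r : {mpoly K[n]}) (f g : 'End(V)).

Lemma poly_fun_eq0 p : (forall v : V, poly_fun p v = 0) -> p = 0.
Proof.
move=> p0; apply: mpoly_eval_eq0 => w.
rewrite -(p0 (\sum_i w i *: (vbasis {:V})`_i)); apply: meval_eq => i.
by rewrite coord_sum_free // (basis_free (vbasisP _)).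
Qed.

Lemma poly_funM p q (v : V) : poly_fun (p * q) v = poly_fun p v * poly_fun q v.
Proof. exact: mevalM. Qed.

Lemma poly_funD p q (v : V) : poly_fun (p + q) v = poly_fun p v + poly_fun q v.
Proof. exact: mevalD. Qed.

Lemma poly_funB p q (v : V) : poly_fun (p - q) v = poly_fun p v - poly_fun q v.
Proof. exact: mevalB. Qed.

Lemma poly_funZ c p (v : V) : poly_fun (c *: p) v = c * poly_fun p v.
Proof. exact: mevalZ. Qed.

Lemma poly_funXn p j (v : V) : poly_fun (p ^+ j) v = poly_fun p v ^+ j.
Proof. exact: (rmorphXn (meval _)). Qed.

Lemma poly_fun0 (v : V) : poly_fun 0 v = 0.
Proof. exact: meval0. Qed.

Lemma poly_funC c (v : V) : poly_fun c%:MP v = c.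
Proof. exact: mevalC. Qed.

Lemma poly_funX m (v : V) :
  poly_fun 'X_[m] v = \prod_i coord (vbasis {:V}) i v ^+ m i.
Proof. exact: mevalX. Qed.

Lemma poly_funXU i (v : V) : poly_fun 'X_i v = coord (vbasis {:V}) i v.
Proof. exact: mevalXU. Qed.

Lemma poly_fun_sum (I : Type) (s : seq I) (F : I -> {mpoly K[n]}) (v : V) :
  poly_fun (\sum_(j <- s) F j) v = \sum_(j <- s) poly_fun (F j) v.
Proof. exact: (raddf_sum (meval _)). Qed.

Lemma poly_fun_prod (I : Type) (s : seq I) (F : I -> {mpoly K[n]}) (v : V) :
  poly_fun (\prod_(j <- s) F j) v = \prod_(j <- s) poly_fun (F j) v.
Proof. exact: (rmorph_prod (meval _)). Qed.

Lemma poly_fun_inj p q : (forall v : V, poly_fun p v = poly_fun q v) -> p = q.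
Proof.
move=> e; apply/eqP; rewrite -subr_eq0; apply/eqP/poly_fun_eq0 => v.
by rewrite poly_funB e subrr.
Qed.

(** The pullback of [p] along [f], in the coordinates of [vbasis]; it reverses composition. *)
Definition linear_subst f p : {mpoly K[n]} :=
  p \mPo [tuple \sum_(j < n) coord (vbasis {:V}) i (f (vbasis {:V})`_j) *: 'X_j
         | i < n].

Lemma poly_fun_linear_subst f p v :
  poly_fun (linear_subst f p) v = poly_fun p (f v).
Proof.
rewrite /poly_fun comp_mpoly_meval; apply: meval_eq => i.
rewrite tnth_mktuple raddf_sum /= {2}(coord_vbasis (memvf v)).
rewrite linear_sum /= linear_sum /=.
by apply: eq_bigr => j _; rewrite mevalZ mevalXU linearZ /= linearZ /= mulrC.
Qed.

Lemma linear_substM f p q :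
  linear_subst f (p * q) = linear_subst f p * linear_subst f q.
Proof. exact: rmorphM. Qed.

Lemma linear_substD f p q :
  linear_subst f (p + q) = linear_subst f p + linear_subst f q.
Proof. exact: comp_mpolyD. Qed.

Lemma linear_substZ f c p : linear_subst f (c *: p) = c *: linear_subst f p.
Proof. exact: comp_mpolyZ. Qed.

Lemma linear_subst0 f : linear_subst f 0 = 0.
Proof. exact: comp_mpoly0. Qed.

Lemma linear_substC f c : linear_subst f c%:MP = c%:MP.
Proof. exact: comp_mpolyC. Qed.

Lemma mcoeff_scale (c : K) p m :
  (linear_subst (c *: \1)%VF p)@_m = c ^+ mdeg m * p@_m.
Proof.
rewrite /linear_subst; set t := [tuple _ | _ < _].
have bfree := basis_free (vbasisP {:V}).
have et i : tnth t i = c *: 'X_i.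
  rewrite tnth_mktuple (bigD1 i) //= big1 ?addr0 => [|j ji].
    rewrite scale_lfunE id_lfunE linearZ /= coord_free ?bfree //.
    by rewrite eqxx mulr1.
  rewrite scale_lfunE id_lfunE linearZ /= coord_free ?bfree //.
  by rewrite (negPf ji) mulr0 scale0r.
exact: mcoeff_comp_scale et _ _.
Qed.

Opaque poly_fun linear_subst.

Lemma linear_subst_comp f g p :
  linear_subst g (linear_subst f p) = linear_subst (f \o g)%VF p.
Proof.
apply: poly_fun_inj => v; rewrite (poly_fun_linear_subst (f \o g)) comp_lfunE.
by rewrite (poly_fun_linear_subst g) (poly_fun_linear_subst f).
Qed.

Lemma linear_subst1 p : linear_subst \1%VF p = p.
Proof. by apply: poly_fun_inj => v; rewrite poly_fun_linear_subst id_lfunE. Qed.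

(* Applying the hypothesis to [f] and to its inverse makes [q o f] and [q]
   associate, without any bound on degrees. *)
Lemma coprime_semi_invariant f p q k : lker f == 0%VS -> q != 0 ->
    (forall r, divides q (p * r) -> divides q r) ->
    linear_subst f p * q = (p + k *: q) * linear_subst f q ->
  exists2 c, c != 0 & linear_subst f q = c *: q.
Proof.
move=> f0 q0 copq e; set g := (f^-1)%VF.
have fgK p' : linear_subst g (linear_subst f p') = p'.
  by rewrite linear_subst_comp lker0_compfV // linear_subst1.
have gfK p' : linear_subst f (linear_subst g p') = p'.
  by rewrite linear_subst_comp lker0_compVf // linear_subst1.
have [r er] : divides q (linear_subst f q).
  apply: copq; exists (linear_subst f p - k *: linear_subst f q).
  by rewrite mulrBr [X in _ = X - _]mulrC e -!mul_mpolyC; ring.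
have [s es] : divides q (linear_subst g q).
  apply: copq; exists (linear_subst g p + k *: linear_subst g q).
  have := congr1 (linear_subst g) e.
  rewrite (linear_substM g (linear_subst f p)) (linear_substM g (p + _)).
  rewrite !fgK (linear_substD g p) (linear_substZ g k) => e'.
  by rewrite e' mulrC.
(* Substituting [g] in [er] and inserting [es] gives [q] back, so the two quotients cancel; a unit
   among polynomials is a constant. *)
have eg : linear_subst g r * s = 1.
  apply: (mulfI q0); rewrite mulr1 -[RHS]fgK er linear_substM es; ring.
have [c ec] : exists c, linear_subst g r = c%:MP.
  have : linear_subst g r \is a GRing.unit by apply/unitrPr; exists s.
  by rewrite unfold_in /= => /andP[/eqP-> _]; exists (linear_subst g r)@_0.
have er' : r = c%:MP by rewrite -[r]gfK ec linear_substC.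
exists c; last by rewrite er er' mulrC mul_mpolyC.
by apply: contra_eq_neq eg => c0; rewrite ec c0 mpolyC0 mul0r eq_sym oner_neq0.
Qed.

Lemma linear_subst_neq0 f q : lker f == 0%VS -> q != 0 ->
  linear_subst f q != 0.
Proof.
move=> f0; apply: contraNneq => e.
rewrite -[q]linear_subst1 -(lker0_compfV f0) -linear_subst_comp e.
by rewrite linear_subst0.
Qed.

(** Some equation [s] of the complement is nonzero at [v0]. The product [p * s] vanishes both on and
    off [Omega], hence is zero, and [s] is not. *)
Lemma open_dense (Omega : V -> Prop) (S : {mpoly K[n]} -> Prop) (v0 : V) p :
    (forall v, ~ Omega v <-> forall s, S s -> poly_fun s v = 0) -> Omega v0 ->
  (forall v, Omega v -> poly_fun p v = 0) -> p = 0.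
Proof.
move=> eS Ov0 p0.
have [s Ss s0] : exists2 s, S s & poly_fun s v0 != 0.
  apply: contrapT => H; have : ~ Omega v0; last by apply.
  apply/eS => s Ss; apply/eqP/negPn/negP => s0; apply: H.
  by exists s.
have : p * s = 0.
  apply: poly_fun_eq0 => v; rewrite poly_funM.
  have [/p0->|/eS/(_ s Ss)->] := EM (Omega v); first by rewrite mul0r.
  by rewrite mulr0.
move/eqP; rewrite mulf_eq0 => /orP[/eqP//|/eqP s00].
by move: s0; rewrite s00 poly_fun0 eqxx.
Qed.

End Substitution.

(** * Regular functions on a matrix group *)

Section RegularFunctions.
Variables (K : numFieldType) (m : nat) (G : 'M[K]_m -> Prop).

(* For [K := R[i]] this is convertible to [regular_on G]. *)
Definition regular_fun (F : 'M[K]_m -> K) :=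
  exists p k, forall g, G g -> F g = poly_fun p g / (\det g) ^+ k.

Lemma regular_fun_ext F1 F2 :
  (forall g, G g -> F1 g = F2 g) -> regular_fun F1 -> regular_fun F2.
Proof. by move=> e [p [k H]]; exists p, k => g Gg; rewrite -e // H. Qed.

Lemma regular_fun_const c : regular_fun (fun=> c).
Proof.
by exists c%:MP, 0%N => g _; rewrite expr0 divr1 poly_funC.
Qed.

Lemma regular_fun_mul F1 F2 :
  regular_fun F1 -> regular_fun F2 -> regular_fun (fun g => F1 g * F2 g).
Proof.
move=> [p [k H]] [q [l H']]; exists (p * q), (k + l)%N => g Gg.
by rewrite H // H' // poly_funM exprD invfM mulrACA.
Qed.

Lemma regular_fun_exp F j : regular_fun F -> regular_fun (fun g => F g ^+ j).
Proof.
move=> rF; elim: j => [|j IH]; first exact: regular_fun_const.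
apply: (@regular_fun_ext (fun g => F g * F g ^+ j)).
  by move=> g _; rewrite exprS.
exact: regular_fun_mul.
Qed.

Lemma regular_fun_prod (I : Type) (s : seq I) (F : I -> 'M[K]_m -> K) :
  (forall i, regular_fun (F i)) -> regular_fun (fun g => \prod_(i <- s) F i g).
Proof.
move=> rF; elim: s => [|i s IH].
  apply: (@regular_fun_ext (fun=> 1)); last exact: regular_fun_const.
  by move=> g _; rewrite big_nil.
apply: (@regular_fun_ext (fun g => F i g * \prod_(j <- s) F j g)).
  by move=> g _; rewrite big_cons.
exact: regular_fun_mul.
Qed.

Hypothesis GLG : forall g, G g -> g \in unitmx.

(** Coordinates are taken in [vbasis], so each matrix entry is first written as a linear form
    [X i j], then put into the Leibniz formula. Sums of regular functions use this to reach a common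
    denominator. *)
Lemma regular_fun_det : exists d, forall g : 'M[K]_m, poly_fun d g = \det g.
Proof.
pose b := vbasis {:'M[K]_m}.
pose X (i j : 'I_m) : {mpoly K[\dim {:'M[K]_m}]} :=
  \sum_(k : 'I_(\dim {: 'M[K]_m})) b`_k i j *: 'X_k.
exists (\sum_(s : 'S_m) (-1) ^+ s *: \prod_i X i (s i)) => g.
rewrite poly_fun_sum; apply: eq_bigr => s _.
rewrite poly_funZ poly_fun_prod; congr (_ * _); apply: eq_bigr => i _.
rewrite poly_fun_sum [in RHS](coord_vbasis (memvf g)) summxE.
by apply: eq_bigr => j _; rewrite poly_funZ poly_funXU mxE mulrC.
Qed.

Lemma regular_fun_add F1 F2 :
  regular_fun F1 -> regular_fun F2 -> regular_fun (fun g => F1 g + F2 g).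
Proof.
have [d ed] := regular_fun_det.
have edX g j : poly_fun (d ^+ j) g = (\det g) ^+ j by rewrite poly_funXn ed.
move=> [p [k H]] [q [l H']].
exists (p * d ^+ l + q * d ^+ k), (k + l)%N => g Gg.
have g0 : \det g != 0 by rewrite -unitfE; exact: GLG.
rewrite H // H' // poly_funD !poly_funM !edX exprD.
by field; rewrite !expf_neq0.
Qed.

(** Gives the regularity of the character of the denominator [q], which up to a constant is the
    value of [q] along an orbit. *)
Lemma regular_fun_orbit_map (V : vectType K) (rho : 'M[K]_m -> 'End(V)) p v :
  (forall i, regular_fun (fun g => coord (vbasis {:V}) i (rho g v))) ->
  regular_fun (fun g => poly_fun p (rho g v)).
Proof.
move=> reg; elim/mpolyind: p => [|c M p _ _ IH].
  apply: (@regular_fun_ext (fun=> 0)); last exact: regular_fun_const.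
  by move=> g _; rewrite poly_fun0.
apply: (@regular_fun_ext (fun g =>
  c * (\prod_i coord (vbasis {:V}) i (rho g v) ^+ M i) + poly_fun p (rho g v))).
  by move=> g _; rewrite poly_funD poly_funZ poly_funX.
apply: regular_fun_add IH; apply: regular_fun_mul.
  exact: regular_fun_const.
by apply: regular_fun_prod => i; apply: regular_fun_exp.
Qed.

End RegularFunctions.

(** * Semi-invariance and homogeneity of numerator and denominator *)

Lemma scale_semi_invariant_homog (K : numFieldType) (V : vectType K)
    (p q : {mpoly K[\dim {:V}]}) (e k : K) :
    q != 0 -> linear_subst (2 *: \1)%VF q = e *: q ->
    linear_subst (2 *: \1)%VF p = e *: (p + k *: q) ->
  exists d, p \is d.-homog /\ q \is d.-homog.
Proof.
move=> q0 eq ep; pose d := mdeg (mlead q).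
have pow2 a b : 2 ^+ a = 2 ^+ b :> K -> a = b.
  by move/eqP; rewrite -!natrX Num.Theory.eqr_nat eqn_exp2l // => /eqP.
have cq m : 2 ^+ mdeg m * q@_m = e * q@_m by rewrite -mcoeff_scale eq mcoeffZ.
have ee : e = 2 ^+ d.
  by have := cq (mlead q); move/mulIf => -> //; rewrite mleadc_eq0.
have hq : q \is d.-homog.
  apply/dhomogP => m; rewrite mcoeff_msupp => qm0.
  by apply: pow2; have := cq m; rewrite ee; apply: mulIf.
(* Away from degree [d] the term [k *: q] has no coefficient, so there too a nonzero coefficient of
   [p] is scaled by [e], forcing degree [d] after all. *)
exists d; split=> //; apply/dhomogP => m; rewrite mcoeff_msupp => pm0.
apply/eqP/negPn/negP => md; have := mcoeff_scale 2 p m.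
rewrite ep mcoeffZ mcoeffD mcoeffZ (dhomog_nemf_coeff hq md) mulr0 addr0.
by move/(mulIf pm0); rewrite ee => /pow2 e2; rewrite e2 eqxx in md.
Qed.

Section AdditiveInvariant.
Variables (K : numFieldType) (V : vectType K) (T : Type) (G : T -> Prop).
Variables (rho : T -> 'End(V)) (Omega : V -> Prop) (Phi : T -> K).
Variables p q : {mpoly K[\dim {:V}]}.
Hypothesis rho_inj : forall g, G g -> lker (rho g) == 0%VS.
Hypothesis transitive : forall v w, Omega v -> Omega w ->
  exists2 g, G g & rho g v = w.
Hypothesis dense : forall F, (forall v, Omega v -> poly_fun F v = 0) -> F = 0.
Hypothesis q_neq0 : q != 0.
Hypothesis coprime_pq : forall r, divides q (p * r) -> divides q r.
Hypothesis additive : forall g v, G g -> Omega v ->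
  poly_fun q v != 0 -> poly_fun q (rho g v) != 0 ->
  poly_fun p (rho g v) / poly_fun q (rho g v) - poly_fun p v / poly_fun q v
    = Phi g.

Lemma generic_point F : F != 0 -> exists2 v, Omega v & poly_fun F v != 0.
Proof.
move=> F0; apply: contrapT => H; case/eqP: F0; apply: dense => v Ov.
by apply/eqP/negPn/negP => Fv; apply: H; exists v.
Qed.

(** The identity is known only at points of [Omega] where both denominators are nonzero. Multiplying
    the difference by these denominators makes it vanish on all of [Omega]; density applies and they
    cancel. *)
Lemma translate_numerator g : G g -> linear_subst (rho g) p * q
  = (p + Phi g *: q) * linear_subst (rho g) q.
Proof.
move=> Gg; apply/eqP; rewrite -subr_eq0; set D := (_ - _).
have qg0 : linear_subst (rho g) q != 0.
  exact: linear_subst_neq0 (rho_inj Gg) _.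
have : D * (q * linear_subst (rho g) q) = 0.
  apply: dense => v Ov; rewrite !poly_funM.
  have [->|qv] := eqVneq (poly_fun q v) 0; first by rewrite !(mul0r, mulr0).
  have [->|qgv] := eqVneq (poly_fun (linear_subst (rho g) q) v) 0.
    by rewrite !mulr0.
  suff -> : poly_fun D v = 0 by rewrite mul0r.
  rewrite poly_fun_linear_subst in qgv.
  rewrite /D poly_funB !poly_funM poly_funD poly_funZ !poly_fun_linear_subst.
  by rewrite -(additive Gg Ov qv qgv); field; rewrite qv qgv.
by move/eqP; rewrite !mulf_eq0 (negPf q_neq0) (negPf qg0) !orbF.
Qed.

Lemma additive_invariant_structure : exists v1 d,
  [/\ Omega v1, poly_fun q v1 != 0,
      forall g, G g -> poly_fun q (rho g v1) != 0,
      forall g v, G g -> poly_fun q (rho g v)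
        = poly_fun q (rho g v1) / poly_fun q v1 * poly_fun q v
    & p \is d.-homog /\ q \is d.-homog].
Proof.
have [v1 Ov1 qv1] := generic_point q_neq0.
pose chi g := poly_fun q (rho g v1) / poly_fun q v1.
have chiE g : G g -> chi g != 0 /\ linear_subst (rho g) q = chi g *: q.
  move=> Gg.
  have [c c0 ec] := coprime_semi_invariant (rho_inj Gg) q_neq0 coprime_pq
    (translate_numerator Gg).
  (* Evaluating at [v1], where [q] is nonzero, identifies the constant and gives it a formula in
     [g]. *)
  suff -> : chi g = c by [].
  by rewrite /chi -poly_fun_linear_subst ec poly_funZ mulfK.
have qE g v : G g -> poly_fun q (rho g v) = chi g * poly_fun q v.
  by move=> Gg; rewrite -poly_fun_linear_subst (chiE _ Gg).2 poly_funZ.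
have pE g v : G g ->
    poly_fun p (rho g v) = chi g * (poly_fun p v + Phi g * poly_fun q v).
  move=> Gg; rewrite -poly_fun_linear_subst -poly_funZ -poly_funD -poly_funZ.
  congr poly_fun; apply: (mulIf q_neq0).
  by rewrite translate_numerator // (chiE _ Gg).2 -!mul_mpolyC; ring.
pose dil : 'End(V) := (2 *: \1)%VF.
have dil_inj : lker dil == 0%VS.
  apply/lker0P => x y; rewrite !scale_lfunE !id_lfunE.
  by apply: scalerI; rewrite Num.Theory.pnatr_eq0.
(* [N / M] is the difference between the dilated fraction [p / q] and [p / q] itself. *)
pose N := linear_subst dil p * q - p * linear_subst dil q.
pose M := linear_subst dil q * q.
have M0 : M != 0 by rewrite mulf_neq0 // linear_subst_neq0.
have dilG g v : dil (rho g v) = rho g (dil v).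
  by rewrite !scale_lfunE !id_lfunE linearZ.
(* The dilation commutes with [rho g], so the two contributions of [Phi g] are equal and cancel. *)
have NG g v : G g -> poly_fun N (rho g v) = chi g ^+ 2 * poly_fun N v.
  move=> Gg; rewrite !poly_funB !poly_funM !poly_fun_linear_subst dilG.
  by rewrite !pE ?qE //; ring.
have MG g v : G g -> poly_fun M (rho g v) = chi g ^+ 2 * poly_fun M v.
  by move=> Gg; rewrite !poly_funM !poly_fun_linear_subst dilG !qE //; ring.
have [v2 Ov2 Mv2] := generic_point M0.
pose k := poly_fun N v2 / poly_fun M v2.
(* [N] and [M] have the same character, so their ratio keeps along the whole orbit its value at
   [v2]. *)
have eN : N = k *: M.
  apply/eqP; rewrite -subr_eq0; apply/eqP/dense => v Ov.
  have [g Gg <-] := transitive Ov2 Ov.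
  by rewrite poly_funB poly_funZ NG // MG // /k; field.
have dilP : linear_subst dil p * q = (p + k *: q) * linear_subst dil q.
  apply/eqP; rewrite -subr_eq0 mulrDl opprD addrA -/N eN /M -!mul_mpolyC.
  by apply/eqP; ring.
have [e e0 eq] := coprime_semi_invariant dil_inj q_neq0 coprime_pq dilP.
have ep : linear_subst dil p = e *: (p + k *: q).
  by apply: (mulIf q_neq0); rewrite dilP eq -!mul_mpolyC; ring.
have [d hpq] := scale_semi_invariant_homog q_neq0 eq ep.
exists v1, d; split=> // g Gg; have [] := chiE _ Gg.
by rewrite mulf_eq0 negb_or => /andP[].
Qed.

End AdditiveInvariant.

(** * Values of fractions, and the conclusion for prehomogeneous spaces *)

Lemma fraction_value (K : numFieldType) (V : vectType K)
    (q x y : {mpoly K[\dim {:V}]}) (v : V) :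
  tofrac q = tofrac x / tofrac y -> poly_fun y v != 0 ->
  poly_fun x v / poly_fun y v = poly_fun q v.
Proof.
move=> e y0.
have ny0 : y != 0 by apply: contraNneq y0 => ->; rewrite poly_fun0.
have -> : x = q * y.
  by apply/eqP; rewrite -tofrac_eq rmorphM /= e mulfVK // tofrac_eq0.
by rewrite poly_funM mulfK.
Qed.

Theorem proposition3p5 (R : realType) (m : nat) (G : set 'M[R[i]]_m)
    (V : vectType R[i]) (rho : 'M[R[i]]_m -> 'End(V)) (Omega : set V)
    (hV : prehomogeneous G rho Omega)
    (h : {fraction {mpoly R[i][\dim {:V}]}})
    (hinv : additive_relative_invariant G rho Omega h)
    (hneq0 : h != 0) :
  exists (h1 f1 : {mpoly R[i][\dim {:V}]}) (d : nat),
    [/\ h = tofrac h1 / tofrac f1,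
        h1 != 0 /\ h1 \is d.-homog,
        f1 != 0 /\ f1 \is d.-homog,
        no_common_factor h1 f1
      & relative_invariant G rho Omega (tofrac f1)].
Proof.
have [[[Z _ GZ] G1 GM GV] _ [rinj rM rreg] [v0 eOm] [S eS]] := hV.
have [Phi _ hPhi] := hinv.
have GLG g : G g -> g \in unitmx by rewrite GZ => -[].
have [p [q [q0 eh cop]]] := reduced_fraction h (@factorial_mpoly _ _).
have p0 : p != 0 by apply: contraNneq hneq0 => p0; rewrite eh p0 tofrac0 mul0r.
(* [Omega] is an image of [G], so the identity of [G] supplies a point of it; density is established
   from that point. *)
have Om1 : Omega (rho 1%:M v0) by rewrite eOm; exists 1%:M.
have transitive v w : Omega v -> Omega w -> exists2 g, G g & rho g v = w.
  rewrite eOm => -[g1 Gg1 <-] [g2 Gg2 <-].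
  exists (g2 *m invmx g1); first by apply: GM => //; apply: GV.
  rewrite -comp_lfunE -rM ?mulmxKV ?GLG //; by apply: GM => //; apply: GV.
have dense F : (forall v, Omega v -> poly_fun F v = 0) -> F = 0.
  apply: (@open_dense _ V Omega S (rho 1%:M v0)) => // v.
  have -> : (~ Omega v) = (~` Omega)%classic v by [].
  by rewrite eS.
have additive g v : G g -> Omega v ->
    poly_fun q v != 0 -> poly_fun q (rho g v) != 0 ->
    poly_fun p (rho g v) / poly_fun q (rho g v) - poly_fun p v / poly_fun q v
      = Phi g.
  by move=> Gg Ov qv qgv; apply: (hPhi v) => //; exists p, q.
have [v1 [deg [Ov1 qv1 qgv1 qE [hp hq]]]] :=
  additive_invariant_structure rinj transitive dense q0 cop additive.
exists p, q, deg; split; [exact: eh | by [] | by [] | |].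
  by move=> r; apply: coprime_common_divisor.
split; first by rewrite tofrac_eq0.
pose chi g := poly_fun q (rho g v1) / poly_fun q v1.
exists chi => [|v g x y Ov Gg [x1 [x2 [ex x20 ->]]] [y1 [y2 [ey y20 ->]]]].
  split=> [g Gg|g g' Gg Gg'|].
  - by rewrite mulf_neq0 ?invr_neq0 ?qgv1.
  (* Semi-invariance of [q] is applied at the point [rho g' v1]. *)
  - by rewrite /chi rM // comp_lfunE qE // mulrA.
  apply: regular_fun_mul; last exact: regular_fun_const.
  exact: (regular_fun_orbit_map GLG _ (rreg v1)).
(* Whatever quotients represent [tofrac q] at the two points, their values are those of the
   polynomial [q]. *)
rewrite [LHS](fraction_value ey y20) qE //; congr (_ * _).
by rewrite [RHS](fraction_value ex x20).
Qed.
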